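(* Let $X,Y,Z,W$ be normed spaces and let $f:X\times Y\times Z\to W$ be a bounded tri-linear map. The following statements are equivalent: (1) $f$ is close-to-regular, i.e. $f^{t****s}=f^{s****t}$ on $X^{**}\times Y^{**}\times Z^{**}$. (2) $f^{s***t*}(Y^{**},W^{*},Z)\subseteq X^{*}$ and $f^{s******}(X^{**},W^{*},Y^{**})\subseteq Z^{*}$. (3) $f^{t*****}(W^{*},Z^{**},X^{**})\subseteq Y^{*}$.
   Context: Adjoint: for a bounded tri-linear map $g:E_1\times E_2\times E_3\to E$ of normed spaces, its adjoint is the bounded tri-linear map $g^{*}:E^{*}\times E_1\times E_2\to E_3^{*}$, $\langle g^{*}(e^{*},e_1,e_2),e_3\rangle=\langle e^{*},g(e_1,e_2,e_3)\rangle$. Iterating, $g^{**}=(g^* )^*:E_3^{**}\times E^{*}\times E_1\to E_2^{*}$, $g^{***}:E_2^{**}\times E_3^{**}\times E^{*}\to E_1^{*}$, $g^{****}:E_1^{**}\times E_2^{**}\times E_3^{**}\to E^{**}$, and so on. Flips: $g^{t}:E_3\times E_1\times E_2\to E$, $g^{t}(e_3,e_1,e_2)=g(e_1,e_2,e_3)$; $g^{s}:E_2\times E_3\times E_1\to E$, $g^{s}(e_2,e_3,e_1)=g(e_1,e_2,e_3)$. Superscripts are applied successively from left to right (e.g. $f^{t****s}=((f^{t})^{****})^{s}$, $f^{s***t*}=(((f^{s})^{***})^{t})^{*}$). Every normed space is identified with its canonical image in its second dual (so e.g. $W^*\subseteq W^{***}$, $X^{**}\subseteq X^{****}$, $Z\subseteq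 Z^{**}$, and an inclusion such as $f^{t*****}(W^{*},Z^{**},X^{**})\subseteq Y^{*}$ means that the values, which lie in $Y^{***}$, belong to the canonical image of $Y^*$). $g(A,B,C)$ denotes the set of values $g(a,b,c)$, $a\in A,b\in B,c\in C$. *)

(* Defs.v *)
From HB Require Import structures.
From mathcomp Require Import all_boot all_order all_algebra.
From mathcomp Require Import complex ring.
From mathcomp Require Import boolp classical_sets functions reals.
From mathcomp Require Import topology normedtype.

Set Implicit Arguments.
Unset Strict Implicit.
Unset Printing Implicit Defensive.

Import Order.TTheory GRing.Theory Num.Theory.
Import numFieldNormedType.Exports.

Local Open Scope classical_set_scope.
Local Open Scope ring_scope.

(* The scalar field of normed spaces: real or complex.  Norms of a
   [normedModType K] take their values in [K] itself, so operator norms need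
   suprema of bounded sets of nonnegative elements of [K].  The two intended
   models, [R : realType] and [R[i]], are built below.  They are the only ones:
   the real elements of such a field form a complete ordered field, over which
   [K] is a field with a multiplicative norm, so Gelfand-Mazur applies. *)
HB.mixin Record hasNonnegSup K & Num.NumField K := {
  nonneg_sup : forall A : set K, A !=set0 -> (forall a, A a -> 0 <= a) ->
    has_ubound A -> supremums A !=set0
}.

#[short(type="scalarType")]
HB.structure Definition Scalar := {K of Num.NumField K & hasNonnegSup K}.

Lemma real_nonneg_sup (R : realType) (A : set R) : A !=set0 ->
  (forall a, A a -> 0 <= a) -> has_ubound A -> supremums A !=set0.
Proof.
move=> A0 _ Aub; exists (sup A); split; first exact: sup_upper_bound.
by move=> x Ax; exact: ge_sup.
Qed.

Definition real_scalar (R : realType) : scalarType :=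
  HB.pack_for scalarType R (hasNonnegSup.Build R (@real_nonneg_sup R)).

Lemma complex_nonneg_sup (R : realType) (A : set R[i]) : A !=set0 ->
  (forall a, A a -> 0 <= a) -> has_ubound A -> supremums A !=set0.
Proof.
move=> [a0 Aa0] Age0 [M AM].
have Are a : A a -> a = ((complex.Re a)%:C)%C.
  by case: a => x y /Age0; rewrite lecE /= => /andP[/eqP->].
have ubE b : ubound A b <->
    complex.Im b = 0 /\ ubound ((@complex.Re R) @` A) (complex.Re b).
  split=> [Ab|[b0 Ab] a Aa].
    split.
      move: (Ab _ Aa0) (Age0 _ Aa0); rewrite !lecE /=.
      by move=> /andP[/eqP<- _] /andP[/eqP-> _].
    by move=> _ [a Aa <-]; move: (Ab _ Aa); rewrite lecE => /andP[].
  rewrite lecE b0 {1}(Are _ Aa) /= eqxx /=; apply: Ab; exact: imageP.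
have hs : has_sup ((@complex.Re R) @` A).
  split; first by exists (complex.Re a0); exact: imageP.
  by exists (complex.Re M); apply (ubE M).
exists ((sup ((@complex.Re R) @` A))%:C)%C; split.
  by apply/ubE; split=> //=; exact: sup_upper_bound.
move=> b /ubE[b0 Ab]; rewrite lecE /= b0 eqxx /=.
by apply: ge_sup => //; case: hs.
Qed.

Definition complex_scalar (R : realType) : scalarType :=
  HB.pack_for scalarType R[i] (hasNonnegSup.Build R[i] (@complex_nonneg_sup R)).

Section Dual.
Variables (K : scalarType) (E : normedModType K).

Definition is_dual : pred (E -> K^o) :=
  fun f => `[< linear f /\ continuous f >].

Record dual := Dual { dual_fun :> E -> K^o; dualP : is_dual dual_fun }.

HB.instance Definition _ := [isSub for dual_fun].
HB.instance Definition _ := [Choice of dual by <:].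

Lemma is_dual_submod : submod_closed is_dual.
Proof.
split; first by apply/asboolP; split;
  [move=> a x y; rewrite scaler0 addr0|exact: cst_continuous].
move=> a f g /asboolP[lf cf] /asboolP[lg cg]; apply/asboolP; split.
  move=> b x y; rewrite !fctE lf lg !scalerDr !scalerA mulrC.
  by rewrite -!addrA; congr (_ + _); rewrite addrCA.
move=> x; apply: cvgD; last exact: cg.
by apply: cvgZl_tmp; exact: cf.
Qed.

HB.instance Definition _ :=
  GRing.isSubmodClosed.Build K (E -> K^o) is_dual is_dual_submod.
HB.instance Definition _ := [SubChoice_isSubLmodule of dual by <:].

Lemma dual_linear (f : dual) : linear f.
Proof. by have /asboolP[] := dualP f. Qed.

Lemma dual_continuous (f : dual) : continuous f.
Proof. by have /asboolP[] := dualP f. Qed.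

HB.instance Definition _ (f : dual) :=
  GRing.isLinear.Build K E K^o _ f (dual_linear f).

Lemma dual_ext (f g : dual) : (forall x, f x = g x) -> f = g.
Proof. by move=> fg; apply: val_inj; apply/funext. Qed.

Lemma dualDE (f g : dual) x : (f + g) x = f x + g x. Proof. by []. Qed.

Lemma dualZE a (f : dual) x : (a *: f) x = a *: f x. Proof. by []. Qed.

Lemma dual0E x : (0 : dual) x = 0. Proof. by []. Qed.

Definition unit_values (f : dual) : set K :=
  [set `|f x| | x in [set x | `|x| <= 1]].

(* The operator norm; [dual_norm_sup] shows that the supremum exists in
   [K], so the default value of [supremum] is never used. *)
Definition dual_norm (f : dual) : K := supremum 0 (unit_values f).

Lemma dual_bounded (f : dual) : exists2 M, 0 <= M & forall x, `|f x| <= M * `|x|.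
Proof.
have /linear_bounded_continuous/linear_boundedP := @dual_continuous f.
move=> /pinfty_ex_gt0[M M0 fM]; exists M => //; exact: ltW.
Qed.

Lemma unit_values0 (f : dual) : unit_values f 0.
Proof. by exists 0; rewrite /= ?linear0 ?normr0. Qed.

Lemma dual_norm_sup (f : dual) : supremums (unit_values f) (dual_norm f).
Proof.
have n0 : unit_values f !=set0 by exists 0; exact: unit_values0.
have /(nonneg_sup _ n0) : forall a, unit_values f a -> 0 <= a.
  by move=> _ [x _ <-].
case=> [|s fs].
  have [M M0 fM] := dual_bounded f; exists M => _ [x /= x1 <-].
  by rewrite (le_trans (fM x))// ler_piMr.
rewrite /dual_norm /supremum; case: ifPn => [/eqP f0|_]; last exact: xgetI fs.
by move: n0; rewrite f0 => -[].
Qed.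

Lemma dual_norm_ge0 (f : dual) : 0 <= dual_norm f.
Proof. by apply: (dual_norm_sup f).1; exact: unit_values0. Qed.

Lemma dual_normP (f : dual) x : `|f x| <= dual_norm f * `|x|.
Proof.
have [->|x0] := eqVneq x 0; first by rewrite linear0 !normr0 mulr0.
rewrite -ler_pdivrMr ?normr_gt0//; apply: (dual_norm_sup f).1.
exists (`|x|^-1 *: x); rewrite /= ?linearZ/= normrZ normfV normr_id.
  by rewrite mulVf ?normr_eq0.
by rewrite mulrC.
Qed.

Lemma dual_norm_le (f : dual) M : 0 <= M -> (forall x, `|f x| <= M * `|x|) ->
  dual_norm f <= M.
Proof.
move=> M0 fM; apply: (dual_norm_sup f).2 => _ [x /= x1 <-].
by rewrite (le_trans (fM x))// ler_piMr.
Qed.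

Lemma dual_normD (f g : dual) : dual_norm (f + g) <= dual_norm f + dual_norm g.
Proof.
apply: dual_norm_le => [|x]; first by rewrite addr_ge0 ?dual_norm_ge0.
by rewrite dualDE (le_trans (ler_normD _ _))// mulrDl lerD ?dual_normP.
Qed.

Lemma dual_normZ a (f : dual) : dual_norm (a *: f) = `|a| * dual_norm f.
Proof.
have le b (g : dual) : dual_norm (b *: g) <= `|b| * dual_norm g.
  apply: dual_norm_le => [|x]; first by rewrite mulr_ge0 ?dual_norm_ge0.
  by rewrite dualZE normrZ -mulrA ler_wpM2l ?dual_normP.
have [->|a0] := eqVneq a 0.
  apply/eqP; rewrite eq_le le /= normr0 mul0r; exact: dual_norm_ge0.
apply/eqP; rewrite eq_le le /= -ler_pdivlMl ?normr_gt0// -normfV.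
by rewrite (le_trans _ (le _ _))// scalerA mulVf// scale1r.
Qed.

Lemma dual_norm_eq0 (f : dual) : dual_norm f = 0 -> f = 0.
Proof.
move=> f0; apply: dual_ext => x; apply/eqP; rewrite dual0E -normr_le0.
by rewrite (le_trans (dual_normP f x))// f0 mul0r.
Qed.

HB.instance Definition _ :=
  Lmodule_isNormed.Build K dual dual_normD dual_normZ dual_norm_eq0.

Lemma dual_norm_bound (f : dual) x : `|f x| <= `|f| * `|x|.
Proof. exact: dual_normP. Qed.

Lemma dual_le_norm (f : dual) M : 0 <= M -> (forall x, `|f x| <= M * `|x|) ->
  `|f| <= M.
Proof. exact: dual_norm_le. Qed.

Lemma bounded_is_dual (f : E -> K^o) M : 0 <= M -> linear f ->
  (forall x, `|f x| <= M * `|x|) -> is_dual f.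
Proof.
move=> M0 lf fM; apply/asboolP; split=> //.
pose g : {linear E -> K^o} := HB.pack f (GRing.isLinear.Build K E K^o _ f lf).
apply: (@bounded_linear_continuous _ _ _ g); apply/linear_boundedP.
near=> r => x; rewrite (le_trans (fM x))// ler_wpM2r//.
by near: r; apply: nbhs_pinfty_ge; rewrite ger0_real.
Unshelve. all: by end_near. Qed.

End Dual.

Section Canonical.
Variables (K : scalarType) (E : normedModType K).

Lemma bidual_emb_subproof (x : E) : is_dual (fun f : dual E => f x : K^o).
Proof.
apply: (@bounded_is_dual _ _ _ `|x|) => //.
by move=> f; rewrite mulrC; exact: dual_norm_bound.
Qed.

Definition bidual_emb (x : E) : dual (dual E) := Dual (bidual_emb_subproof x).

(* [E] as a subset of its second dual. *)
Definition canon_image : set (dual (dual E)) := range bidual_emb.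

End Canonical.

Arguments canon_image {K} E.

Record trilinear (K : scalarType) (E1 E2 E3 E : normedModType K) := Trilinear {
  tri_fun :> E1 -> E2 -> E3 -> E;
  tri_linear1 : forall e2 e3, linear (fun e1 => tri_fun e1 e2 e3);
  tri_linear2 : forall e1 e3, linear (fun e2 => tri_fun e1 e2 e3);
  tri_linear3 : forall e1 e2, linear (fun e3 => tri_fun e1 e2 e3);
  tri_bounded : exists M : K, forall e1 e2 e3,
    `|tri_fun e1 e2 e3| <= M * `|e1| * `|e2| * `|e3|
}.

Section Trilinear.
Variables (K : scalarType) (E1 E2 E3 E : normedModType K).
Variable g : trilinear E1 E2 E3 E.

Lemma tri_bounded_ge0 : exists2 M : K, 0 <= M &
  forall e1 e2 e3, `|g e1 e2 e3| <= M * `|e1| * `|e2| * `|e3|.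
Proof.
have [M gM] := tri_bounded g; exists `|M| => // e1 e2 e3.
rewrite (le_trans (gM e1 e2 e3))// -[leLHS]ger0_norm ?(le_trans _ (gM _ _ _))//.
by rewrite !normrM !normr_id.
Qed.

Lemma adj_subproof (phi : dual E) e1 e2 :
  is_dual (fun e3 => phi (g e1 e2 e3) : K^o).
Proof.
have [M M0 gM] := tri_bounded_ge0.
apply: (@bounded_is_dual _ _ _ (`|phi| * (M * `|e1| * `|e2|))).
- by rewrite !mulr_ge0.
- by move=> a x y; rewrite (tri_linear3 g) linearP.
- move=> e3; rewrite (le_trans (dual_norm_bound phi _))//.
  by rewrite -[leRHS]mulrA ler_wpM2l.
Qed.

Definition adj_fun (phi : dual E) e1 e2 : dual E3 := Dual (adj_subproof phi e1 e2).

Lemma adj_linear1 e1 e2 : linear (fun phi => adj_fun phi e1 e2).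
Proof. by move=> a x y; exact: dual_ext. Qed.

Lemma adj_linear2 phi e2 : linear (fun e1 => adj_fun phi e1 e2).
Proof.
move=> a x y; apply: dual_ext => e3.
by rewrite dualDE dualZE /= (tri_linear1 g) linearP.
Qed.

Lemma adj_linear3 phi e1 : linear (fun e2 => adj_fun phi e1 e2).
Proof.
move=> a x y; apply: dual_ext => e3.
by rewrite dualDE dualZE /= (tri_linear2 g) linearP.
Qed.

Lemma adj_bounded : exists M : K, forall phi e1 e2,
  `|adj_fun phi e1 e2| <= M * `|phi| * `|e1| * `|e2|.
Proof.
have [M M0 gM] := tri_bounded_ge0; exists M => phi e1 e2.
apply: dual_le_norm => [|e3]; first by rewrite !mulr_ge0.
rewrite (le_trans (dual_norm_bound phi _))//.
have -> : M * `|phi| * `|e1| * `|e2| * `|e3| =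
  `|phi| * (M * `|e1| * `|e2| * `|e3|) by ring.
by rewrite ler_wpM2l.
Qed.

(* The adjoint g^* : E^* x E_1 x E_2 -> E_3^*,
   <g^*(phi, e_1, e_2), e_3> = <phi, g(e_1, e_2, e_3)>. *)
Definition adj : trilinear (dual E) E1 E2 (dual E3) :=
  Trilinear adj_linear1 adj_linear2 adj_linear3 adj_bounded.

Lemma adjE phi e1 e2 e3 : adj phi e1 e2 e3 = phi (g e1 e2 e3).
Proof. by []. Qed.

Lemma flipt_bounded : exists M : K, forall e3 e1 e2,
  `|g e1 e2 e3| <= M * `|e3| * `|e1| * `|e2|.
Proof.
have [M gM] := tri_bounded g; exists M => e3 e1 e2.
by have -> : M * `|e3| * `|e1| * `|e2| = M * `|e1| * `|e2| * `|e3| by ring.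
Qed.

(* g^t(e_3, e_1, e_2) = g(e_1, e_2, e_3) *)
Definition flipt : trilinear E3 E1 E2 E :=
  @Trilinear K E3 E1 E2 E (fun e3 e1 e2 => g e1 e2 e3)
    (fun e1 e2 => tri_linear3 g e1 e2) (fun e3 e2 => tri_linear1 g e2 e3)
    (fun e3 e1 => tri_linear2 g e1 e3) flipt_bounded.

Lemma flips_bounded : exists M : K, forall e2 e3 e1,
  `|g e1 e2 e3| <= M * `|e2| * `|e3| * `|e1|.
Proof.
have [M gM] := tri_bounded g; exists M => e2 e3 e1.
by have -> : M * `|e2| * `|e3| * `|e1| = M * `|e1| * `|e2| * `|e3| by ring.
Qed.

(* g^s(e_2, e_3, e_1) = g(e_1, e_2, e_3) *)
Definition flips : trilinear E2 E3 E1 E :=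
  @Trilinear K E2 E3 E1 E (fun e2 e3 e1 => g e1 e2 e3)
    (fun e3 e1 => tri_linear2 g e1 e3) (fun e2 e1 => tri_linear3 g e1 e2)
    (fun e2 e3 => tri_linear1 g e2 e3) flips_bounded.

Definition tri_image (A : set E1) (B : set E2) (C : set E3) : set E :=
  [set e | exists e1 e2 e3, [/\ A e1, B e2, C e3 & e = g e1 e2 e3]].

End Trilinear.

(* f^{t****s} = f^{s****t} on X^** x Y^** x Z^** *)
Definition close_to_regular (K : scalarType) (X Y Z W : normedModType K)
    (f : trilinear X Y Z W) : Prop :=
  forall (x : dual (dual X)) (y : dual (dual Y)) (z : dual (dual Z)),
    flips (adj (adj (adj (adj (flipt f))))) x y z =
    flipt (adj (adj (adj (adj (flips f))))) x y z.

(* Main.v *)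
Require Import Defs.
From mathcomp Require Import all_boot all_order all_algebra.
From mathcomp Require Import boolp classical_sets functions reals.
From mathcomp Require Import topology normedtype.

Set Implicit Arguments.
Unset Strict Implicit.
Unset Printing Implicit Defensive.

Local Open Scope classical_set_scope.

(** Fix [phi] in [W^*] and regard an element of a bidual as the weak-star limit
    of a bounded net of the space.  An iterated adjoint is then an iterated limit
    of [phi (f x y z)], and
    [f^{t****}(z'', x'', y'') phi] is [lim_z lim_x lim_y phi (f x y z)], while
    [f^{s****}(y'', z'', x'') phi] is [lim_y lim_z lim_x phi (f x y z)].
    Close-to-regularity says that these two iterated limits agree.

    Each of the inclusions asks whether a functional [F] on a bidual [E^**]
    comes from [E^*].  The only candidate is the restriction of [F] to [E], so
    by [canon_image_dualP] the inclusion is an equality of iterated limits in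
    which the limit along [E] changes its place:
    - in [statement3] the limit along [Y] moves from innermost to outermost,
      which is exactly the equality of the two limits above
      ([close_to_regular_iff_inclY]);
    - the first inclusion of [statement2] interchanges [lim_x] and [lim_y]
      at a fixed [z] in [Z], which is the case [z'' = z] of that equality
      ([inclX_iff_regular_at]);
    - the second inclusion of [statement2] says that [lim_y lim_z lim_x]
      equals [lim_z lim_y lim_x].  Once the first inclusion lets the two inner limits
      be interchanged, the latter is [lim_z lim_x lim_y]
      ([inclZ_iff_regular]). *)

(** Since [E^*] is determined by its values on [E], a functional on [E^**] that
    restricts to [p] on [E] can only come from [p]. *)
Lemma canon_image_dualP (K : scalarType) (E : normedModType K)
    (F : dual (dual (dual E))) (p : dual E) :
  (forall e, F (bidual_emb e) = p e) ->
  canon_image (dual E) F <-> (forall e, F e = e p).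
Proof.
move=> Fp; split=> [[q _ qF] e|Fe]; last first.
  by exists p => //; apply: dual_ext => e; rewrite Fe.
suff -> : p = q by rewrite -qF.
by apply: dual_ext => e0; rewrite -Fp -qF.
Qed.

Section CloseToRegular.
Variables (K : scalarType) (X Y Z W : normedModType K).
Variable f : trilinear X Y Z W.

Let ft2 := adj (adj (flipt f)).
Let ft3 := adj ft2.
Let ft4 := adj ft3.
Let fs3 := adj (adj (adj (flips f))).
Let fs4 := adj fs3.

Definition regular_at (z : dual (dual Z)) : Prop :=
  forall x y phi, fs4 y z x phi = ft4 z x y phi.

Lemma close_to_regularP : close_to_regular f <-> forall z, regular_at z.
Proof.
split=> [reg z x y phi|reg x y z]; last by apply: dual_ext => phi; rewrite [RHS]reg.
exact: (esym (congr1 (fun h : dual (dual W) => h phi) (reg x y z))).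
Qed.

(** The functional [y'' |-> f^{t****}(z'', x'', y'') phi] restricts on [Y] to
    [f^{s***}(z'', x'', phi)], and evaluating [y''] at the latter gives
    [f^{s****}(y'', z'', x'') phi]. *)
Lemma close_to_regular_iff_inclY :
  close_to_regular f <->
  tri_image (adj ft4) (canon_image (dual W)) setT setT `<=` canon_image (dual Y).
Proof.
have inclP phi z x : canon_image (dual Y) (adj ft4 (bidual_emb phi) z x) <->
    forall y, ft4 z x y phi = fs4 y z x phi.
  apply: (canon_image_dualP (p := fs3 z x phi)) => y.
  congr (z _); apply: dual_ext => z0.
  by congr (x _); apply: dual_ext.
rewrite close_to_regularP; split=> [reg _ [_ [z [x [[phi _ <-] _ _ ->]]]]|incl z x y phi].
  by apply/inclP => y; rewrite reg.
apply/esym; apply: (inclP phi z x).1; apply: incl.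
by exists (bidual_emb phi), z, x; split=> //; exists phi.
Qed.

(** At a point [z] of [Z], the functional [x'' |-> f^{s****}(y'', z, x'') phi]
    restricts on [X] to [f^{t**}(y'', phi, z)], and evaluating [x''] at the
    latter gives [f^{t****}(z, x'', y'') phi]. *)
Lemma inclX_iff_regular_at :
  tri_image (adj (flipt fs3)) setT setT (canon_image Z)
    `<=` canon_image (dual X) <->
  forall z, regular_at (bidual_emb z).
Proof.
have inclP y phi z :
    canon_image (dual X) (adj (flipt fs3) y phi (bidual_emb z)) <->
    forall x, fs4 y (bidual_emb z) x phi = ft4 (bidual_emb z) x y phi.
  apply: (canon_image_dualP (p := ft2 y phi z)) => x.
  by congr (y _); apply: dual_ext.
split=> [incl z x y phi|reg _ [y [phi [_ [_ _ [z _ <-] ->]]]]].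
  apply: (inclP y phi z).1; apply: incl.
  by exists y, phi, (bidual_emb z); split=> //; exists z.
by apply/inclP => x; exact: reg.
Qed.

(** Regularity at the points of [Z] says that the functional
    [z'' |-> f^{s****}(y'', z'', x'') phi] restricts on [Z] to
    [f^{t***}(x'', y'', phi)], and evaluating [z''] at the latter gives
    [f^{t****}(z'', x'', y'') phi]. *)
Lemma inclZ_iff_regular : (forall z, regular_at (bidual_emb z)) ->
  tri_image (adj (adj fs4)) (canon_image (dual (dual X)))
    (canon_image (dual W)) setT `<=` canon_image (dual Z) <->
  forall z, regular_at z.
Proof.
move=> regZ.
have inclP x phi y : canon_image (dual Z)
      (adj (adj fs4) (bidual_emb x) (bidual_emb phi) y) <->
    forall z, fs4 y z x phi = ft4 z x y phi.
  by apply: (canon_image_dualP (p := ft3 x y phi)) => z; exact: regZ.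
split=> [incl z x y phi|reg _ [_ [_ [y [[x _ <-] [phi _ <-] _ ->]]]]].
  apply: (inclP x phi y).1; apply: incl.
  exists (bidual_emb x), (bidual_emb phi), y.
  by split=> //; [exists x|exists phi].
by apply/inclP => z; exact: reg.
Qed.

Lemma close_to_regular_iff_inclXZ :
  close_to_regular f <->
  tri_image (adj (flipt fs3)) setT setT (canon_image Z)
    `<=` canon_image (dual X) /\
  tri_image (adj (adj fs4)) (canon_image (dual (dual X)))
    (canon_image (dual W)) setT `<=` canon_image (dual Z).
Proof.
rewrite close_to_regularP; split=> [reg|[inclX inclZ]].
  have regZ z : regular_at (bidual_emb z) by exact: reg.
  by split; [exact: inclX_iff_regular_at.2|exact/(inclZ_iff_regular regZ)].
have regZ := inclX_iff_regular_at.1 inclX.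
exact/(inclZ_iff_regular regZ).
Qed.

End CloseToRegular.

Theorem theorem1 (K : scalarType) (X Y Z W : normedModType K)
    (f : trilinear X Y Z W) :
  let statement1 := close_to_regular f in
  let statement2 :=
    (* f^{s***t*}(Y^{**}, W^{*}, Z) is included in X^* *)
    tri_image (adj (flipt (adj (adj (adj (flips f))))))
      [set: dual (dual Y)] [set: dual W] (canon_image Z)
    `<=` canon_image (dual X)
    /\
    (* f^{s******}(X^{**}, W^{*}, Y^{**}) is included in Z^* *)
    tri_image (adj (adj (adj (adj (adj (adj (flips f)))))))
      (canon_image (dual (dual X))) (canon_image (dual W))
      [set: dual (dual Y)]
    `<=` canon_image (dual Z) in
  let statement3 :=
    (* f^{t*****}(W^{*}, Z^{**}, X^{**}) is included in Y^* *)
    tri_image (adj (adj (adj (adj (adj (flipt f))))))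
      (canon_image (dual W)) [set: dual (dual Z)] [set: dual (dual X)]
    `<=` canon_image (dual Y) in
  (statement1 <-> statement2) /\ (statement2 <-> statement3).
Proof.
move=> statement1 statement2 statement3.
have s12 : statement1 <-> statement2 := close_to_regular_iff_inclXZ f.
have s13 : statement1 <-> statement3 := close_to_regular_iff_inclY f.
by split=> //; rewrite -s12.
Qed.
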